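(* Let $\mathcal{E}$ be a finite-dimensional Euclidean space, let $S\subseteq\mathcal{E}$ be a closed convex set with $0\in\mathrm{int}\,S$, and let $y\in\mathcal{E}$ with $\gamma_S(y)\neq0$. If $\frac12\gamma_S^2$ is (locally) $L$-smooth w.r.t. $(y,g)$, where $g\in\partial(\frac12\gamma_S^2)(y)$ and $L\in(0,\infty)$, then the set $S$ is (locally) smooth with parameter $L\,\zeta^T\bar y$ w.r.t. $(\bar y,\zeta)$, where $\bar y=y/\gamma_S(y)$ and $\zeta=g/\|g\|$.
   Context: $\|\cdot\|$ is the Euclidean norm and $B(x,r)$ the closed ball of center $x$ and radius $r$. The gauge of $S$ is $\gamma_S(x)=\inf\{\lambda>0\mid x\in\lambda S\}$. The normal cone at $x\in S$ is $N_S(x)=\{\zeta\mid \zeta^T(z-x)\le 0\ \forall z\in S\}$; $\partial h(x)=\{g\mid h(z)-h(x)\ge g^T(z-x)\ \forall z\}$. Local smoothness of a set: for $\bar y\in\mathrm{bdry}\,S$ and unit $\zeta\in N_S(\bar y)$, $S$ is (locally) $\beta$-smooth w.r.t. $(\bar y,\zeta)$ if for every $\tilde\beta>\beta$ there is $\eta>0$ small enough that $B(\bar y-\frac1{\tilde\beta}\zeta,\frac1{\tilde\beta})\cap B(\bar y,\eta)\subseteq S\cap B(\bar y,\eta)$. Local smoothness of a function: a closed convex function $h$ is (locally) $L$-smooth w.r.t. $(x,g)$, $g\in\partial h(x)$ (necessarily $g=\nabla h(x)$), if for every $\tilde L>L$ there is $\eta>0$ with $h(z)\le h(x)+g^T(z-x)+\frac{\tilde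 L}{2}\|z-x\|^2$ for all $z\in B(x,\eta)$. *)

(* Defs.v *)
(* MathComp / MathComp-Analysis *)
From HB Require Import structures.
From mathcomp Require Import all_boot all_order all_algebra.
From mathcomp Require Import all_classical all_reals all_analysis.
From mathcomp Require Import ring lra.

Set Implicit Arguments.
Unset Strict Implicit.
Unset Printing Implicit Defensive.
Set Warnings "-redundant-canonical-projection".

Import Order.TTheory GRing.Theory Num.Theory.
Import numFieldNormedType.Exports.

Local Open Scope classical_set_scope.
Local Open Scope ring_scope.

(* euclideanType R: finite-dimensional real vector spaces (Vector) with an
   inner product whose norm is the norm of the normed module, so that balls,
   [closed] and [interior] are the Euclidean ones.  Positive definiteness of
   inner follows from normr_inner.  *)
HB.mixin Record NormedModule_isEuclidean (R : realType) E
    & NormedModule R E := {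
  inner : E -> E -> R ;
  innerC : forall x y : E, inner x y = inner y x ;
  innerDl : forall x y z : E, inner (x + y) z = inner x z + inner y z ;
  innerZl : forall (a : R) (x y : E), inner (a *: x) y = a * inner x y ;
  normr_inner : forall x : E, `|x| ^+ 2 = inner x x
}.

#[short(type="euclideanType")]
HB.structure Definition Euclidean (R : realType) :=
  {E of NormedModule R E & Vector R E & NormedModule_isEuclidean R E}.

(* A positive definite inner product alone determines the whole structure. *)
HB.factory Record Vector_isEuclidean (R : realType) E & Vector R E := {
  inner : E -> E -> R ;
  innerC : forall x y : E, inner x y = inner y x ;
  innerDl : forall x y z : E, inner (x + y) z = inner x z + inner y z ;
  innerZl : forall (a : R) (x y : E), inner (a *: x) y = a * inner x y ;
  inner_ge0 : forall x : E, 0 <= inner x x ;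
  inner_eq0 : forall x : E, inner x x = 0 -> x = 0
}.

HB.builders Context (R : realType) E & Vector_isEuclidean R E.

Let nrm (x : E) : R := Num.sqrt (inner x x).

Let innerDr x y z : inner x (y + z) = inner x y + inner x z.
Proof. by rewrite innerC innerDl !(innerC _ x). Qed.

Let innerZr a x y : inner x (a *: y) = a * inner x y.
Proof. by rewrite innerC innerZl innerC. Qed.

Let nrm_sq x : nrm x ^+ 2 = inner x x.
Proof. by rewrite sqr_sqrtr // inner_ge0. Qed.

Let nrm0_eq0 x : nrm x = 0 -> x = 0.
Proof. by move=> x0; apply: inner_eq0; rewrite -nrm_sq x0 expr0n. Qed.

Let cauchy_schwarz x y : inner x y <= nrm x * nrm y.
Proof.
have [/nrm0_eq0 y0|yn0] := eqVneq (nrm y) 0.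
  by rewrite y0 -(scale0r x) innerZr mul0r mulr_ge0 ?sqrtr_ge0.
have [/nrm0_eq0 x0|xn0] := eqVneq (nrm x) 0.
  by rewrite x0 -(scale0r y) innerZl mul0r mulr_ge0 ?sqrtr_ge0.
have x_gt0 : 0 < nrm x by rewrite lt_neqAle eq_sym xn0 sqrtr_ge0.
have y_gt0 : 0 < nrm y by rewrite lt_neqAle eq_sym yn0 sqrtr_ge0.
have := inner_ge0 (nrm y *: x + (- nrm x) *: y).
rewrite !innerDl !innerDr !innerZl !innerZr (innerC y x) -!nrm_sq.
rewrite [leRHS](_ : _ = (nrm x * nrm y * 2) * (nrm x * nrm y - inner x y));
  last by ring.
by rewrite pmulr_rge0 ?subr_ge0 // !mulr_gt0.
Qed.

Let nrmD x y : nrm (x + y) <= nrm x + nrm y.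
Proof.
rewrite -(ler_pXn2r (n := 2)) ?nnegrE ?addr_ge0 ?sqrtr_ge0 //.
rewrite nrm_sq sqrrD innerDl !innerDr -!nrm_sq (innerC y x).
by have := cauchy_schwarz x y; lra.
Qed.

Let nrmZ (l : R) x : nrm (l *: x) = `|l| * nrm x.
Proof.
by rewrite /nrm innerZl innerZr mulrA -expr2 sqrtrM ?sqr_ge0 // sqrtr_sqr.
Qed.

HB.instance Definition _ := Lmodule_isNormed.Build R E nrmD nrmZ nrm0_eq0.
HB.instance Definition _ := NormedModule_isEuclidean.Build R E
  innerC innerDl innerZl nrm_sq.

HB.end.

(* R^n with the dot product; an alias, since 'rV[R]_n carries the max norm. *)
Definition euclidean_space (R : realType) (n : nat) : Type := 'rV[R]_n.

Section euclidean_space.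
Variables (R : realType) (n : nat).
Local Notation E := (euclidean_space R n).

HB.instance Definition _ := Vector.copy E 'rV[R]_n.

Let dot (x y : E) : R := \sum_(i < n) x ord0 i * y ord0 i.

Let dotC x y : dot x y = dot y x.
Proof. by apply: eq_bigr => i _; rewrite mulrC. Qed.

Let dotDl x y z : dot (x + y) z = dot x z + dot y z.
Proof. by rewrite -big_split; apply: eq_bigr => i _; rewrite mxE mulrDl. Qed.

Let dotZl a x y : dot (a *: x) y = a * dot x y.
Proof. by rewrite mulr_sumr; apply: eq_bigr => i _; rewrite mxE mulrA. Qed.

Let dot_ge0 x : 0 <= dot x x.
Proof. by apply: sumr_ge0 => i _; rewrite -expr2 sqr_ge0. Qed.

Let dot_eq0 x : dot x x = 0 -> x = 0.
Proof.
move/eqP; rewrite psumr_eq0 => [/allP x0|i _]; last by rewrite -expr2 sqr_ge0.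
apply/rowP => i; rewrite mxE.
by have := x0 i (mem_index_enum i); rewrite mulf_eq0 orbb => /eqP.
Qed.

HB.instance Definition _ := Vector_isEuclidean.Build R E
  dotC dotDl dotZl dot_ge0 dot_eq0.

End euclidean_space.

Section local_smoothness.
Variables (R : realType) (E : euclideanType R).
Implicit Types (S : set E) (h : E -> R) (x g zeta : E).

(* Real-valued: the infimum is over a nonempty set as soon as 0 is interior
   to S ([inf set0 = 0] is junk otherwise).  *)
Definition gauge_of S x : R :=
  inf [set lambda : R | 0 < lambda /\ [set lambda *: s | s in S] x].

Definition boundary S : set E := closure S `\` S°.

Definition normal_cone S x : set E :=
  [set zeta | forall z, S z -> inner zeta (z - x) <= 0].

Definition subdifferential h x : set E :=
  [set g | forall z, h z - h x >= inner g (z - x)].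

(* The side conditions under which set smoothness is meant (ybar a boundary
   point, zeta a unit normal there) are part of the predicate.  *)
Definition locally_smooth_set S (beta : R) (ybar zeta : E) :=
  [/\ boundary S ybar, `|zeta| = 1, normal_cone S ybar zeta &
    forall beta' : R, beta < beta' -> exists2 eta : R, 0 < eta &
      closed_ball (ybar - beta'^-1 *: zeta) beta'^-1 `&` closed_ball ybar eta
      `<=` S `&` closed_ball ybar eta].

(* Meant for closed convex h; neither property is assumed. *)
Definition locally_smooth_fun h (L : R) x g :=
  subdifferential h x g /\
  forall L' : R, L < L' -> exists2 eta : R, 0 < eta &
    forall z, closed_ball x eta z ->
      h z <= h x + inner g (z - x) + L' / 2 * `|z - x| ^+ 2.

End local_smoothness.

(* Main.v *)
(* Writing m = gamma_S(y), testing the subgradient inequality along the ray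
   R_+ y and using that h = gamma_S^2 / 2 is homogeneous of degree 2 gives
   <g, y> = m^2; in particular g <> 0, and <g, ybar> = m.  Rescaling by m, the
   smoothness inequality at y becomes
     gamma_S(w)^2 <= 1 + (2 / m) <g, w - ybar> + L' |w - ybar|^2
   for w near ybar.  Membership of w in the ball of radius 1 / beta' centred at
   ybar - zeta / beta' means |w - ybar|^2 <= - (2 / beta') <zeta, w - ybar>, so
   with L' = beta' |g| / m the last two terms have a nonpositive sum, and
   gamma_S(w) <= 1, i.e. w belongs to S.  *)
Require Import Defs.
From mathcomp Require Import all_boot all_order all_algebra.
From mathcomp Require Import all_classical all_reals all_analysis.
From mathcomp Require Import ring lra.

Set Implicit Arguments.
Unset Strict Implicit.
Unset Printing Implicit Defensive.

Import Order.TTheory GRing.Theory Num.Theory.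
Import numFieldNormedType.Exports.

Local Open Scope classical_set_scope.
Local Open Scope ring_scope.

Section inner_product.
Variables (R : realType) (E : euclideanType R).
Implicit Types x y z : E.

Lemma innerDr x y z : inner x (y + z) = inner x y + inner x z.
Proof. by rewrite innerC innerDl !(innerC _ x). Qed.

Lemma innerZr (a : R) x y : inner x (a *: y) = a * inner x y.
Proof. by rewrite innerC innerZl innerC. Qed.

Lemma innerNr x y : inner x (- y) = - inner x y.
Proof. by rewrite -scaleN1r innerZr mulN1r. Qed.

Lemma innerBr x y z : inner x (y - z) = inner x y - inner x z.
Proof. by rewrite innerDr innerNr. Qed.

Lemma inner0l x : inner 0 x = 0.
Proof. by rewrite -(scale0r x) innerZl mul0r. Qed.

Lemma normrD_sqr x y :
  `|x + y| ^+ 2 = `|x| ^+ 2 + 2 * inner x y + `|y| ^+ 2.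
Proof. by rewrite !normr_inner innerDl !innerDr (innerC y x); ring. Qed.

End inner_product.

Section gauge.
Variables (R : realType) (E : euclideanType R).
Implicit Types (S : set E) (x y : E).

Local Notation scalings S x :=
  [set lambda : R | 0 < lambda /\ [set lambda *: s | s in S] x].

Lemma has_lbound_scalings S x : has_lbound (scalings S x).
Proof. by exists 0 => l [/ltW]. Qed.

Lemma gauge_of_ge0 S x : 0 <= gauge_of S x.
Proof.
rewrite /gauge_of; have [ne|/inf_out->//] := pselect (has_inf (scalings S x)).
by apply: lb_le_inf => [|l [/ltW]//]; case: ne.
Qed.

Lemma gauge_of_le S x (l : R) : 0 < l -> S (l^-1 *: x) -> gauge_of S x <= l.
Proof.
move=> l0 Sx; apply: ge_inf; first exact: has_lbound_scalings.
by split => //; exists (l^-1 *: x) => //; rewrite scalerA divff ?gt_eqF ?scale1r.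
Qed.

Lemma gauge_of_le1 S x : S x -> gauge_of S x <= 1.
Proof. by move=> Sx; apply: gauge_of_le; rewrite ?invr1 ?scale1r. Qed.

(** Multiplication by [t] carries the scalings of [x] bijectively onto those of [t *: x]. *)
Lemma gauge_ofZ_le S (t : R) x :
  0 < t -> gauge_of S (t *: x) <= t * gauge_of S x.
Proof.
move=> t0; have scalings_t l : scalings S (t *: x) (t * l) <-> scalings S x l.
  rewrite /= pmulr_rgt0 //; split=> -[l0 [s Ss e]]; split=> //; exists s => //.
    by apply: (scalerI (lt0r_neq0 t0)); rewrite scalerA.
  by rewrite -e scalerA.
rewrite mulrC -ler_pdivrMr //.
have [[l lx]|x0] := pselect (scalings S x !=set0).
  apply: lb_le_inf; first by exists l.
  move=> k /scalings_t kx; rewrite ler_pdivrMr // mulrC.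
  exact: ge_inf (has_lbound_scalings _ _) _ kx.
(* Without scalings of [x] there are none of [t *: x] either, and its gauge is the default value 0
   of [inf]. *)
rewrite ler_pdivrMr // {1}/gauge_of inf_out ?mulr_ge0 ?gauge_of_ge0 ?(ltW t0) //.
case=> -[l lx] _; apply: x0; exists (t^-1 * l).
by apply/scalings_t; rewrite mulrA divff ?gt_eqF // mul1r.
Qed.

Lemma gauge_ofZ S (t : R) x : 0 < t -> gauge_of S (t *: x) = t * gauge_of S x.
Proof.
move=> t0; apply/eqP; rewrite eq_le gauge_ofZ_le //=.
rewrite -ler_pdivlMl // -{1}[x](scalerK (lt0r_neq0 t0)).
by rewrite gauge_ofZ_le ?invr_gt0.
Qed.

Lemma scalings_nonempty S x : S° 0 -> scalings S x !=set0.
Proof.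
move=> /nbhs_normP[r /= r0 rS].
(* Adding 1 makes the denominator positive even at [x = 0] and puts the rescaled point strictly
   inside the ball of radius [r]. *)
have n1 : 0 < `|x| + 1 by rewrite ltr_wpDl.
exists ((`|x| + 1) / r); split; first exact: divr_gt0.
exists ((r / (`|x| + 1)) *: x).
  apply: rS; rewrite /ball_ /= sub0r normrN normrZ ger0_norm ?divr_ge0
    ?(ltW r0) ?(ltW n1) //.
  by rewrite mulrAC ltr_pdivrMr // ltr_pM2l // ltrDl.
rewrite scalerA mulrA mulfVK ?gt_eqF // divff ?gt_eqF //.
by rewrite scale1r.
Qed.

Lemma convex_set_scale S x (t : R) :
  convex_set S -> S 0 -> S x -> 0 <= t <= 1 -> S (t *: x).
Proof.
move=> Sconvex S0 Sx /andP[t0 t1].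
have := @Sconvex x 0 (Itv01 t0 t1) (mem_set Sx) (mem_set S0).
by rewrite /conv /= scaler0 addr0 => /set_mem.
Qed.

(** By closedness it suffices to approximate [x] by points of [S]. Take a scaling [l] close to the
    infimum, with [x = l *: s]: if [l <= 1], then [x] lies on the segment from 0 to [s]; otherwise
    [s] itself is close to [x]. *)
Lemma gauge_of_le1_mem S x : closed S -> convex_set S -> S° 0 ->
  gauge_of S x <= 1 -> S x.
Proof.
move=> Sclosed Sconvex S0 x1; rewrite [S](closure_id _).1 // => B.
move=> /nbhs_normP[e /= e0 eB].
have n1 : 0 < `|x| + 1 by rewrite ltr_wpDl.
(* This tolerance yields [(l - 1) * (|x| + 1) < e], which bounds the distance from [s] to [x] when
   [l > 1]. *)
have [l [l0 [s Ss lsx]] lt_l] := inf_adherent (divr_gt0 e0 n1)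
  (conj (scalings_nonempty x S0) (has_lbound_scalings S x)).
have {}lt_l := lt_le_trans lt_l (lerD x1 (lexx _)).
have [l1|l1] := leP l 1.
  exists x; split; last by apply: eB; rewrite /ball_ /= subrr normr0.
  rewrite -lsx; apply: convex_set_scale => //; last by rewrite (ltW l0).
  exact: interior_subset S0.
exists s; split=> //; apply: eB; rewrite /ball_ /= -lsx.
have -> : l *: s - s = (l - 1) *: s by rewrite scalerBl scale1r.
have ls : `|s| <= `|x|.
  by rewrite -lsx normrZ gtr0_norm // ler_peMl // ltW.
rewrite normrZ gtr0_norm ?subr_gt0 //.
have le' : (l - 1) * (`|x| + 1) < e by rewrite -ltr_pdivlMr // ltrBlDl.
apply: le_lt_trans le'; rewrite ler_pM2l ?subr_gt0 //.
by apply: le_trans ls _; rewrite lerDl.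
Qed.

End gauge.

Section normal_cone.
Variables (R : realType) (E : euclideanType R).
Implicit Types (S : set E) (x zeta : E).

(** From an interior point, a step of length [r / 2] along [zeta] stays in [S] but increases the
    inner product with [zeta]. *)
Lemma normal_cone_not_interior S x zeta :
  normal_cone S x zeta -> zeta != 0 -> ~ S° x.
Proof.
move=> Nzeta zeta0 /nbhs_normP[r /= r0 rS].
have n0 : 0 < `|zeta| by rewrite normr_gt0.
have c0 : 0 < r / (2 * `|zeta|) by rewrite divr_gt0 // mulr_gt0.
have /Nzeta : S (x + (r / (2 * `|zeta|)) *: zeta).
  apply: rS; rewrite /ball_ /= opprD addNKr normrN normrZ gtr0_norm //.
  by rewrite invfM mulrA mulfVK ?gt_eqF //; lra.
rewrite addrC addKr innerZr -normr_inner leNgt.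
by rewrite mulr_gt0 ?exprn_gt0.
Qed.

(** At [t *: x], the subgradient inequality divided by [t - 1] compares [inner zeta x] with
    [(t + 1) * m ^+ 2 / 2], from above for [t > 1] and from below for [t < 1]; both bounds tend to
    [m ^+ 2] as [t] tends to 1. *)
Lemma subdifferential_sqr_gauge S x zeta :
  subdifferential (fun z => gauge_of S z ^+ 2 / 2) x zeta ->
  inner zeta x = gauge_of S x ^+ 2.
Proof.
move=> sub; set m := gauge_of S x.
have ray (t : R) : 0 < t ->
    (t - 1) * inner zeta x <= (t - 1) * ((t + 1) * m ^+ 2 / 2).
  move=> t0; have := sub (t *: x); rewrite /= gauge_ofZ // -/m.
  rewrite innerBr innerZr.
  have -> : (t * m) ^+ 2 / 2 - m ^+ 2 / 2 = (t - 1) * ((t + 1) * m ^+ 2 / 2).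
    by field.
  by rewrite !mulrBl !mul1r.
have up e : 0 < e -> inner zeta x <= m ^+ 2 + e.
  move=> e0; pose d := e / (m ^+ 2 + 1).
  have m1 : 0 < m ^+ 2 + 1 by rewrite ltr_wpDl ?sqr_ge0.
  have d0 : 0 < d by exact: divr_gt0.
  have := ray (1 + d) (addr_gt0 ltr01 d0); rewrite addrAC subrr add0r ler_pM2l //.
  have : d * (m ^+ 2 + 1) = e by rewrite mulfVK ?gt_eqF.
  nra.
have low e : 0 < e -> m ^+ 2 <= inner zeta x + e.
  (* The extra [e] in the denominator ensures [d < 1], so that [1 - d] is an admissible ray
     parameter. *)
  move=> e0; pose d := e / (m ^+ 2 + 1 + e).
  have m0 : 0 <= m ^+ 2 by exact: sqr_ge0.
  have m1 : 0 < m ^+ 2 + 1 + e by lra.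
  have d0 : 0 < d by exact: divr_gt0.
  have dE : d * (m ^+ 2 + 1 + e) = e by rewrite mulfVK ?gt_eqF.
  have d1 : d < 1 by rewrite ltr_pdivrMr // mul1r; lra.
  have := ray (1 - d); rewrite subr_gt0 => /(_ d1).
  rewrite addrAC subrr add0r !mulNr lerN2 ler_pM2l //.
  nra.
by apply/eqP; rewrite eq_le; apply/andP; split; apply/ler_addgt0Pr.
Qed.

End normal_cone.

Theorem theorem18 (R : realType) (E : euclideanType R) (S : set E)
    (Sclosed : closed S) (Sconvex : convex_set S) (S0 : S° 0)
    (y : E) (gauge_y : gauge_of S y != 0) (g : E) (L : R) (L_gt0 : 0 < L)
    (h := fun x : E => gauge_of S x ^+ 2 / 2)
    (g_sub : subdifferential h y g)
    (h_smooth : locally_smooth_fun h L y g)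
    (ybar := (gauge_of S y)^-1 *: y) (zeta := `|g|^-1 *: g) :
  locally_smooth_set S (L * inner zeta ybar) ybar zeta.
Proof.
set m := gauge_of S y in gauge_y ybar *.
have m0 : 0 < m by rewrite lt_def gauge_y gauge_of_ge0.
have yE : y = m *: ybar by rewrite scalerA divff // scale1r.
have gybar : inner g ybar = m.
  rewrite innerZr (subdifferential_sqr_gauge g_sub) -/m expr2 mulrA.
  by rewrite mulVf // mul1r.
have g_neq0 : g != 0.
  by apply: contra_eq_neq gybar => ->; rewrite inner0l eq_sym.
have n0 : 0 < `|g| by rewrite normr_gt0.
have gE : g = `|g| *: zeta by rewrite scalerA divff ?gt_eqF // scale1r.
have zeta1 : `|zeta| = 1 by rewrite normrZ normfV normr_id mulVf ?gt_eqF.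
have gauge_ybar : gauge_of S ybar = 1 by rewrite gauge_ofZ ?invr_gt0 // mulVf.
have Nzeta : normal_cone S ybar zeta.
  move=> z Sz; rewrite innerZl pmulr_rle0 ?invr_gt0 //.
  (* Since [z] has gauge at most 1, [m *: z] has gauge at most that of [y], so [h] does not increase
     from [y] to [m *: z]. *)
  have := g_sub (m *: z); rewrite {1}yE -scalerBr innerZr.
  have gz : h (m *: z) - h y <= 0.
    rewrite /h gauge_ofZ // -/m subr_le0 ler_pM2r ?invr_gt0 //.
    rewrite ler_pXn2r ?nnegrE ?mulr_ge0 ?gauge_of_ge0 ?(ltW m0) //.
    by rewrite ler_piMr ?gauge_of_le1 ?(ltW m0).
  by move=> /le_trans/(_ gz); rewrite pmulr_rle0.
split => //.
  split; last by apply: normal_cone_not_interior Nzeta _; rewrite -normr_gt0 zeta1.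
  by apply: subset_closure; apply: gauge_of_le1_mem; rewrite ?gauge_ybar.
have -> : inner zeta ybar = m / `|g| by rewrite innerZl gybar mulrC.
move=> b Lb.
have b0 : 0 < b by apply: lt_trans Lb; rewrite mulr_gt0 ?divr_gt0.
have Lb' : L < b * `|g| / m by rewrite ltr_pdivlMr // -ltr_pdivrMr // -mulrA.
have [eta eta0 smooth] := h_smooth.2 _ Lb'.
(* Scaling by [m] sends [ybar] to [y], hence the ball of radius [eta / m] at [ybar] into the ball of
   radius [eta] at [y]. *)
exists (eta / m); first exact: divr_gt0.
move=> w [wb we]; split => //; apply: gauge_of_le1_mem => //.
move: wb we.
rewrite !closed_ballE ?invr_gt0 ?divr_gt0 // /closed_ball_ /=.
set v := w - ybar => wb we.
(* Square the bound [b^-1] on the norm of [v + b^-1 *: zeta] and expand: as [zeta] is a unit vector,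
   the terms [b^-1 ^+ 2] cancel. *)
have {wb} vb : b * `|v| ^+ 2 + 2 * inner zeta v <= 0.
  move: wb; rewrite distrC opprB addrCA -/v addrC.
  rewrite -(@ler_pXn2r _ 2) ?nnegrE ?invr_ge0 ?(ltW b0) //.
  rewrite normrD_sqr normrZ zeta1 mulr1 gtr0_norm ?invr_gt0 // gerDr innerZr.
  rewrite (innerC v) => vb.
  have -> : b * `|v| ^+ 2 + 2 * inner zeta v =
      b * (`|v| ^+ 2 + 2 * (b^-1 * inner zeta v)) by field; rewrite gt_eqF.
  by rewrite pmulr_rle0.
have mwE : m *: w - y = m *: v by rewrite {1}yE -scalerBr.
have near_y : closed_ball y eta (m *: w).
  rewrite closed_ballE // /closed_ball_ /= distrC mwE normrZ gtr0_norm //.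
  by rewrite mulrC -ler_pdivlMr // distrC.
have := smooth _ near_y; rewrite mwE normrZ gtr0_norm //.
rewrite /h gauge_ofZ // -/m innerZr exprMn {1}gE innerZl.
have -> : m ^+ 2 / 2 + m * (`|g| * inner zeta v) +
    b * `|g| / m / 2 * (m * `|v|) ^+ 2 =
    m ^+ 2 / 2 + m * `|g| / 2 * (b * `|v| ^+ 2 + 2 * inner zeta v) by field.
move=> le; have {}le : m ^+ 2 * gauge_of S w ^+ 2 / 2 <= m ^+ 2 / 2.
  apply: le_trans le _; rewrite gerDl pmulr_rle0 //.
  by rewrite divr_gt0 // mulr_gt0.
have {}le : gauge_of S w ^+ 2 <= 1.
  by move: le; rewrite ler_pM2r ?invr_gt0 // ger_pMr ?exprn_gt0.
by rewrite -(@ler_pXn2r _ 2) ?nnegrE ?gauge_of_ge0 // expr1n.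
Qed.
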